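(* Let $\mathcal{F}$ be a filter on $\omega$ extending the Fréchet filter. If at least one of the spaces $\mathcal{F}$ or ${}^{\omega}\mathcal{F}$ is countable dense homogeneous, then $\mathcal{F}$ is non-meager.
   Context: $\mathcal{P}(\omega)$ is the power set of $\omega$, identified via characteristic functions with the Cantor set ${}^{\omega}2$ (product topology, $2=\{0,1\}$ discrete). Every subset of $\mathcal{P}(\omega)$ carries the subspace topology, so it is a separable metrizable space. A filter (on $\omega$) is a set $\mathcal{F}\subset\mathcal{P}(\omega)$ such that (a) $\omega\in\mathcal{F}$ and $\emptyset\notin\mathcal{F}$; (b) if $A,B\in\mathcal{F}$ then $A\cap B\in\mathcal{F}$; (c) if $A\in\mathcal{F}$ and $A\subset B\subset\omega$ then $B\in\mathcal{F}$. The Fréchet filter is $\{x\subset\omega:\omega\setminus x\text{ is finite}\}$. ''Non-meager'' means non-meager as a subset of the Cantor set $\mathcal{P}(\omega)$. The space ${}^{\omega}\mathcal{F}$ is the product of countably infinitely many copies of $\mathcal{F}$ with the product topology. A separable space $X$ is countable dense homogeneous if whenever $D$ and $E$ are countable dense subsets of $X$, there exists a homeomorphism $h:X\to X$ such that $h[D]=E$. *)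

(* Defs.v *)
From mathcomp Require Import all_boot all_classical.
From mathcomp Require Import topology cantor.

Set Implicit Arguments.
Unset Strict Implicit.
Unset Printing Implicit Defensive.

Local Open Scope classical_set_scope.

Section topological_notions.
Context {X : topologicalType}.

Definition nowhere_dense (A : set X) := interior (closure A) = set0.

Definition meager (A : set X) :=
  exists2 N : nat -> set X,
    (forall n, nowhere_dense (N n)) & A = \bigcup_n N n.

Definition homeomorphism (h : X -> X) :=
  continuous h /\
  exists g : X -> X, [/\ cancel h g, cancel g h & continuous g].

End topological_notions.

Definition separable (X : topologicalType) :=
  exists2 D : set X, countable D & dense D.

Definition countable_dense_homogeneous (X : topologicalType) :=
  separable X /\
  forall D E : set X, countable D -> dense D -> countable E -> dense E ->
    exists2 h : X -> X, homeomorphism h & h @` D = E.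

(* A point x of the Cantor space is the characteristic function of the
   subset [set n | x n] of nat; [in_cantor F] is the family F of subsets of
   nat, seen as a subset of the Cantor space through this identification. *)
Definition in_cantor (F : set_system nat) : set cantor_space :=
  [set x : cantor_space | F [set n | x n]].

(* [set_type] carries the topology induced by the Cantor space. *)
Definition family_space (F : set_system nat) : topologicalType :=
  set_type (in_cantor F).

Definition family_power (F : set_system nat) : topologicalType :=
  prod_topology (fun _ : nat => family_space F).

(* Main.v *)
Require Import Defs.
From mathcomp Require Import all_boot all_classical.
From mathcomp Require Import topology cantor.

Set Implicit Arguments.
Unset Strict Implicit.
Unset Printing Implicit Defensive.

Local Open Scope classical_set_scope.

(** Suppose that [F] is meager.  The contradiction comes from two countable
    dense sets that no homeomorphism can exchange, and the property that
    separates them is sparseness: a set is sparse when some countable closed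
    cover of the space meets it in finite sets only.  In a metrizable space a
    sparse set is a G-delta set, and sparseness plays here the role that
    G-delta sets play in the classical argument that a countable dense
    homogeneous meager space is a lambda-set.

    A sparse countable dense set exists because the space X (either [F] or its
    power) is meager in itself: cover X by an increasing sequence of closed
    sets [C n] with empty interior and pick the n-th point of D in the n-th
    basic open set, outside [C n] ([exists_sparse_dense]).  For the power, the
    cover is pulled back along the projection to the first factor.

    If X contains a copy of the Cantor space, a countable dense subset of that
    copy is not sparse: by the Baire category theorem one of the closed sets
    contains a nonempty open piece of the copy, hence infinitely many points of
    the set ([not_sparse_range_pad_true]).  Adding these points to D gives a
    countable dense set that is not sparse, so X is not countable dense
    homogeneous ([not_cdh_sparse]).

    The power always contains a Cantor set, since [F] has two points.  So does
    [F] itself when some [A] in [F] is coinfinite, namely the family of all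
    supersets of [A].  Otherwise [F] is the Frechet filter, which is countable
    and has no isolated point; then the whole space and the complement of a
    point are countable dense sets that no bijection exchanges
    ([frechet_not_cdh]). *)

(** * Sparse sets *)

Section sparse.
Context {X : topologicalType}.
Implicit Types D E : set X.

Definition sparse D := exists C : nat -> set X,
  [/\ forall n, closed (C n), [set: X] `<=` \bigcup_n C n
    & forall n, finite_set (D `&` C n)].

Lemma sparse_subset D E : D `<=` E -> sparse E -> sparse D.
Proof.
move=> DE [C [Ccl Ccov CE]]; exists C; split=> // n.
by apply: sub_finite_set (CE n) => x [/DE].
Qed.

Lemma sparse_homeomorphism (h : X -> X) D :
  homeomorphism h -> sparse D -> sparse (h @` D).
Proof.
move=> [_ [g [hK gK gcont]]] [C [Ccl Ccov CD]].
exists (fun n => g @^-1` C n); split.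
- by move=> n; move/continuous_closedP: gcont; apply.
- by move=> x _; have [n _ Cgx] := Ccov (g x) I; exists n.
- move=> n; apply: sub_finite_set (finite_image h (CD n)).
  by move=> _ [[x Dx <-] /=]; rewrite hK => Cx; exists x.
Qed.

(** Sparseness is hereditary, so adding [E] to [D] destroys it while keeping
    [D] countable and dense. *)
Lemma not_cdh_sparse D E : countable D -> dense D -> sparse D ->
  countable E -> ~ sparse E -> ~ countable_dense_homogeneous X.
Proof.
move=> Dcnt Dden Dsp Ecnt Ensp [_ cdhX].
have DE_dense : dense (D `|` E).
  move=> O O0 oO; have [x [Ox Dx]] := Dden O O0 oO.
  by exists x; split => //; left.
have DE_cnt : countable (D `|` E).
  by rewrite -bigcup2E; apply: bigcup_countable => // -[|[|]] //= _ _.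
have [h hh hDE] := cdhX _ _ Dcnt Dden DE_cnt DE_dense.
have EhD : E `<=` h @` D by rewrite hDE; right.
by apply: Ensp; apply: sparse_subset EhD _; exact: sparse_homeomorphism.
Qed.

(** The point chosen in [B t] avoids [C n] for all [n] up to the code of [t],
    so [C n] only contains the points chosen for the finitely many [t] of code
    smaller than [n]. *)
Lemma exists_sparse_dense (T : countType) (B : T -> set X) (C : nat -> set X) :
    (forall U : set X, open U -> U !=set0 -> exists t, B t `<=` U) ->
    (forall n, closed (C n)) -> (forall m n, m <= n -> C m `<=` C n) ->
    [set: X] `<=` \bigcup_n C n -> (forall t n, B t `\` C n !=set0) ->
  exists D, [/\ countable D, dense D & sparse D].
Proof.
move=> Bbase Ccl Cmono Ccov BC.
have /choice[d dP] : forall t, exists x, (B t `\` C (pickle t)) x.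
  by move=> t; exact: BC.
exists (range d); split.
- exact: card_le_trans (card_image_le _ _) (countableP _).
- move=> O O0 oO; have [t BO] := Bbase O oO O0.
  by exists (d t); split; [apply: BO; have [] := dP t | exists t].
- exists C; split=> // n.
  have fin : finite_set (pickle @^-1` `I_n : set T).
    apply: finite_preimage (finite_II n) => s t _ _.
    exact: (pcan_inj pickleK).
  apply: sub_finite_set (finite_image d fin) => _ [[t _ <-] Cdt].
  exists t => //=; rewrite ltnNge; apply/negP => le_nt.
  by have [_] := dP t; apply; exact: Cmono Cdt.
Qed.

End sparse.

(** * Meager sets *)

Lemma nowhere_dense_dense_setC (Y : topologicalType) (A : set Y) :
  nowhere_dense A -> dense (~` closure A).
Proof.
move=> A0 O [x Ox] oO; apply/set0P/eqP => /disjoints_subset.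
rewrite setCK => OA; have : (closure A)° x.
  by apply: filterS OA _; exact: open_nbhs_nbhs.
by rewrite (A0 : (closure A)° = set0).
Qed.

Lemma meager_closed_cover (Y : topologicalType) (A : set Y) : meager A ->
  exists C : nat -> set Y, [/\ forall n, closed (C n),
    forall m n, m <= n -> C m `<=` C n,
    A `<=` \bigcup_n C n & forall n, dense (~` C n)].
Proof.
move=> [N Nnd ->].
exists (fun n => \big[setU/set0]_(k < n.+1) closure (N k)); split.
- by move=> n; apply: closed_bigsetU => k _; exact: closed_closure.
- move=> m n le_mn; rewrite -!(bigcup_mkord _ (fun k => closure (N k))).
  by apply: bigcup_subset => k /= km; exact: leq_trans km _.
- move=> x [n _ Nx]; exists n => //.
  rewrite big_ord_recr /=; right; exact: subset_closure.
- have Nden k : dense (~` closure (N k)) by exact: nowhere_dense_dense_setC.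
  elim=> [|n IHn]; first by rewrite big_ord_recr big_ord0 /= set0U.
  rewrite big_ord_recr /= setCU setIC; apply: denseI => //.
  by rewrite openC; exact: closed_closure.
Qed.

(** Meagerness is pulled back along [phi] from [Y] to [X].  The last hypothesis
    says that [phi] maps each [B t] to a somewhere dense set in a strong enough
    sense that no [B t] fits inside the preimage of a closed set with empty
    interior. *)
Lemma exists_sparse_dense_of_meager (X Y : topologicalType) (A : set Y)
    (phi : X -> Y) (T : countType) (B : T -> set X) :
    meager A -> continuous phi -> (forall x, A (phi x)) ->
    (forall U : set X, open U -> U !=set0 -> exists t, B t `<=` U) ->
    (forall t O, open O -> dense O -> exists2 x, B t x & O (phi x)) ->
  exists D : set X, [/\ countable D, dense D & sparse D].
Proof.
move=> /meager_closed_cover[C [Ccl Cmono Ccov Cden]] phic phiA Bbase Bdense.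
apply: (@exists_sparse_dense _ T B (fun n => phi @^-1` C n)) => //.
- by move=> n; move/continuous_closedP: phic; apply.
- by move=> m n /Cmono Cmn x; exact: Cmn.
- by move=> x _; have [n _ Cx] := Ccov _ (phiA x); exists n.
- move=> t n; have [|x Bx Cx] := Bdense t _ _ (Cden n); last by exists x.
  by rewrite openC.
Qed.

(** * The product topology *)

(** The sets containing such a box form a filter that converges to [x] in every
    coordinate, hence in the product: this avoids any manipulation of the
    subbase of the product topology. *)
Lemma prod_topology_nbhs (X : topologicalType)
    (x : prod_topology (fun _ : nat => X))
    (U : set (prod_topology (fun _ : nat => X))) :
  nbhs x U -> exists n (V : nat -> set X), (forall i, nbhs (x i) (V i)) /\
    forall y, (forall i, i < n -> V i (y i)) -> U y.
Proof.
pose G : set_system (prod_topology (fun _ : nat => X)) := [set U |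
  exists n (V : nat -> set X), (forall i, nbhs (x i) (V i)) /\
    forall y, (forall i, i < n -> V i (y i)) -> U y].
move: U; rewrite -/(nbhs x `<=` G).
have GF : Filter G.
  split.
  - by exists 0, (fun _ => setT); split=> // i; exact: filterT.
  - move=> P Q [m [V [Vx VP]]] [n [W [Wx WQ]]].
    exists (maxn m n), (fun i => V i `&` W i); split=> [i|y VWy].
      exact: filterI.
    by split; [apply: VP | apply: WQ] => i lti; have [] := VWy i _;
      rewrite // leq_max lti ?orbT.
  - move=> P Q PQ [m [V [Vx VP]]]; exists m, V; split=> // y Vy.
    exact/PQ/VP.
apply/cvg_sup => i A [_ [[W oW <-] Wx WA]].
exists i.+1, (fun j => [set z | j = i -> W z]); split=> [j|y Wy].
  have [->|ji] := eqVneq j i; last first.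
    by apply: filterS filterT => z _ /= ji'; rewrite ji' eqxx in ji.
  by apply: filterS (open_nbhs_nbhs (conj oW Wx)) => z Wz.
by apply: WA; exact: Wy.
Qed.

Lemma continuous_prod {Y X : topologicalType}
    (f : Y -> prod_topology (fun _ : nat => X)) :
  (forall i, continuous (fun y => f y i)) -> continuous f.
Proof.
move=> fc y; apply/cvg_sup => i A [_ [[W oW <-] Wx WA]].
by apply: filterS WA _; apply: fc; exact: open_nbhs_nbhs.
Qed.

(** * Cylinders of the Cantor space *)

(** These sequences represent cofinite sets, so they belong to every filter that
    extends the Frechet filter; they serve as a countable dense set in the
    Cantor space as well as in the filter. *)
Definition pad_true (s : seq bool) : cantor_space := fun i => nth true s i.

Definition cylinder (s : seq bool) : set cantor_space :=
  [set y | forall i, i < size s -> y i = pad_true s i].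

Lemma cylinder_pad_true s : cylinder s (pad_true s). Proof. by []. Qed.

Lemma cylinder_mkseq (y z : cantor_space) n :
  cylinder (mkseq y n) z <-> forall i, i < n -> z i = y i.
Proof.
have padE i : i < n -> pad_true (mkseq y n) i = y i.
  by move=> lti; rewrite /pad_true nth_mkseq.
split=> yz i.
  by move=> ltin; rewrite yz ?size_mkseq ?padE.
by rewrite size_mkseq => ltin; rewrite padE // yz.
Qed.

Lemma cylinder_nbhs (y : cantor_space) U :
  nbhs y U -> exists n, cylinder (mkseq y n) `<=` U.
Proof.
move=> /prod_topology_nbhs[n [V [Vy VU]]]; exists n => z /cylinder_mkseq yz.
by apply: VU => i lti; rewrite yz //; exact: nbhs_singleton.
Qed.

Lemma open_cylinder s : open (cylinder s).
Proof.
rewrite (_ : cylinder s =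
  \bigcap_(i < size s) [set y : cantor_space | y i = pad_true s i]) //.
rewrite bigcap_mkord; apply: (big_ind (@open cantor_space)) => [||i _].
- exact: openT.
- exact: openI.
have projc : continuous (fun y : cantor_space => y i).
  exact: (@proj_continuous nat (fun _ => bool) i).
move/continuousP: projc => /(_ [set pad_true s i]); apply.
exact: discrete_open.
Qed.

Lemma cylinder_extension s (y : cantor_space) U : cylinder s y -> nbhs y U ->
  exists t,
    [/\ size s < size t, cylinder t `<=` cylinder s & cylinder t `<=` U].
Proof.
move=> sy /cylinder_nbhs[n nU]; exists (mkseq y (maxn (size s).+1 n)).
split=> [|z /cylinder_mkseq yz i lti|z /cylinder_mkseq yz].
- by rewrite size_mkseq leq_max leqnn.
- by rewrite yz ?sy // leq_max (leqW lti).
- by apply: nU; apply/cylinder_mkseq => i lti; rewrite yz // leq_max lti orbT.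
Qed.

Lemma dense_open_pad_true s (O : set cantor_space) : open O -> dense O ->
  exists t, cylinder s (pad_true t) /\ O (pad_true t).
Proof.
move=> oO dO; have [|y [sy Oy]] := dO (cylinder s) _ (@open_cylinder s).
  by exists (pad_true s); exact: cylinder_pad_true.
have [t [_ ts tO]] := cylinder_extension sy (open_nbhs_nbhs (conj oO Oy)).
by exists t; split; [apply: ts | apply: tO]; exact: cylinder_pad_true.
Qed.

Lemma continuous_coordinate (Y : topologicalType) n (f : cantor_space -> Y) :
  (forall y z, y n = z n -> f y = f z) -> continuous f.
Proof.
move=> fn y U /nbhs_singleton Ufy.
have : nbhs y (cylinder (mkseq y n.+1)).
  apply: open_nbhs_nbhs; split; first exact: open_cylinder.
  exact/cylinder_mkseq.
apply: filterS => z /cylinder_mkseq/(_ n (ltnSn n)) yz /=.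
by rewrite (fn _ _ yz).
Qed.

(** The Baire category theorem for the Cantor space: if no cylinder is contained
    in a member of the cover, cylinders [s n.+1] inside [s n] that avoid [C n]
    determine a point outside the cover. *)
Lemma closed_cover_cylinder (C : nat -> set cantor_space) :
  (forall n, closed (C n)) -> [set: cantor_space] `<=` \bigcup_n C n ->
  exists n s, cylinder s `<=` C n.
Proof.
move=> Ccl Ccov; apply: contrapT => noC.
have /choice[e eP] : forall ns : nat * seq bool, exists t,
    [/\ size ns.2 < size t, cylinder t `<=` cylinder ns.2
      & cylinder t `<=` ~` C ns.1].
  move=> [n s] /=; have /existsNP[y] : ~ (cylinder s `<=` C n).
    by move=> sC; apply: noC; exists n, s.
  move=> /not_implyP[sy Cy]; apply: (cylinder_extension sy).
  by apply: open_nbhs_nbhs; split; rewrite ?openC.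
pose s := fix s n := if n is n'.+1 then e (n', s n') else [::].
have ssize n : n <= size (s n).
  by elim: n => // n IHn; have [/(leq_ltn_trans IHn)] := eP (n, s n).
have smono m n : m <= n -> cylinder (s n) `<=` cylinder (s m).
  elim: n => [|n IHn]; first by rewrite leqn0 => /eqP ->.
  rewrite leq_eqVlt => /predU1P[-> //|/IHn sub].
  by have [_ /subset_trans + _] := eP (n, s n); apply.
(* size (s i.+1) is at least i.+1, so s i.+1 does fix coordinate i *)
pose z : cantor_space := fun i => pad_true (s i.+1) i.
have zs n : cylinder (s n) z.
  move=> i lti; rewrite /z; have [le|/ltnW le] := leqP n i.+1.
    exact: smono le _ (@cylinder_pad_true _) _ lti.
  by apply/esym/(smono _ _ le _ (@cylinder_pad_true _)); exact: ssize.
have [n _ Cz] := Ccov z I.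
by have [_ _ /(_ z (zs n.+1))] := eP (n, s n); apply.
Qed.

(** Some [C n] pulls back to a set containing a cylinder, and then contains the
    infinitely many points of the set that come from this cylinder. *)
Lemma not_sparse_range_pad_true {X : topologicalType}
    (psi : cantor_space -> X) :
  continuous psi ->
  (forall s, infinite_set (psi @` (cylinder s `&` range pad_true))) ->
  ~ sparse (psi @` range pad_true).
Proof.
move=> psic psiinf [C [Ccl Ccov CE]].
have [] := @closed_cover_cylinder (fun n => psi @^-1` C n).
- by move=> n; move/continuous_closedP: psic; apply.
- by move=> y _; have [n _ Cy] := Ccov (psi y) I; exists n.
- move=> n [s sC]; apply: (psiinf s); apply: sub_finite_set (CE n).
  by move=> _ [y [sy yQ] <-]; split; [exists y | exact: sC].
Qed.

(** * The Frechet filter *)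

Lemma frechet_pad_true s : @frechet_filter nat [set n | pad_true s n].
Proof.
apply: (@sub_finite_set _ _ `I_(size s)); last exact: finite_II.
move=> i /= si; rewrite ltnNge; apply/negP => sizei; apply: si.
by rewrite /pad_true nth_default.
Qed.

Lemma frechet_range_pad_true (y : cantor_space) :
  @frechet_filter nat [set n | y n] -> range pad_true y.
Proof.
move=> /finite_seqP[r rP]; exists (mkseq y (\max_(i <- r) i).+1) => //.
apply/funext => i; rewrite /pad_true.
have [lti|lei] := ltnP i (\max_(i <- r) i).+1.
  by rewrite nth_mkseq.
rewrite nth_default ?size_mkseq //; case: (boolP (y i)) => // /negP ny.
have : [set` r] i by rewrite -rP.
by move=> /(@leq_bigmax_seq _ r xpredT id) /(_ isT); rewrite leqNgt lei.
Qed.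

(** * Continuous images of the Cantor space *)

Definition single_false (s : seq bool) m :=
  s ++ rcons (nseq (m - size s) true) false.

Lemma single_falseE s m i : size s <= m -> size s <= i ->
  pad_true (single_false s m) i = (i != m).
Proof.
move=> sm si; rewrite /pad_true nth_cat ltnNge si /= nth_rcons size_nseq.
rewrite nth_nseq ltn_sub2rE // eqn_sub2rE //.
by case: ltngtP.
Qed.

Lemma cylinder_single_false s m : cylinder s (pad_true (single_false s m)).
Proof. by move=> i lti; rewrite /pad_true nth_cat lti. Qed.

(** The sequences that extend [s] and vanish at a single [m] beyond [s] are
    separated by [psi] as [m] ranges over [M]. *)
Lemma infinite_image_cylinder {X : Type} (psi : cantor_space -> X) s
    (M : set nat) :
    infinite_set M ->
    (forall y z : cantor_space, psi y = psi z -> forall m, M m -> y m = z m) ->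
  infinite_set (psi @` (cylinder s `&` range pad_true)).
Proof.
move=> Minf psiinj.
have Ms_inf : infinite_set (M `\` `I_(size s)) by exact: infinite_setD.
pose f m := psi (pad_true (single_false s m)).
apply: (@sub_infinite_set _ (f @` (M `\` `I_(size s)))).
  move=> _ [m _ <-]; exists (pad_true (single_false s m)) => //.
  by split; [exact: cylinder_single_false | exists (single_false s m)].
rewrite (eq_finite_set (inj_card_eq _)) // => m n.
rewrite !inE => -[Mm /negP sm] [Mn /negP sn] /psiinj/(_ m Mm).
rewrite -leqNgt in sm; rewrite -leqNgt in sn.
by rewrite !single_falseE // eqxx => /esym/negbFE/eqP.
Qed.

(** * The filter and its power *)

Section filter_spaces.
Context (F : set_system nat) (properF : ProperFilter F)
  (frechetF : @frechet_filter nat `<=` F).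

Definition point (y : cantor_space) (Fy : F [set n | y n]) : family_space F :=
  exist _ y (mem_set Fy).

Definition family_pad s : family_space F :=
  point (frechetF (frechet_pad_true s)).

Lemma val_family_pad s : set_val (family_pad s) = pad_true s. Proof. by []. Qed.

Lemma family_space_val (x : family_space F) : in_cantor F (set_val x).
Proof. exact/set_mem/(valP x). Qed.

Lemma family_space_nbhs (x : family_space F) U : nbhs x U ->
  exists n, set_val @^-1` cylinder (mkseq (set_val x) n) `<=` U.
Proof.
move=> [_ [[W oW <-] Wx WU]].
have [n nW] := cylinder_nbhs (open_nbhs_nbhs (conj oW Wx)).
by exists n => z /nW Wz; exact: WU.
Qed.

Lemma family_space_sparse_dense : meager (in_cantor F) ->
  exists D : set (family_space F), [/\ countable D, dense D & sparse D].
Proof.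
move=> /exists_sparse_dense_of_meager meagerF.
apply: (meagerF _ set_val (seq bool) (fun s => set_val @^-1` cylinder s)).
- exact: initial_continuous.
- exact: family_space_val.
- move=> U oU [x Ux].
  have [n nU] := family_space_nbhs (open_nbhs_nbhs (conj oU Ux)).
  by exists (mkseq (set_val x) n).
- move=> s O oO dO; have [t [st Ot]] := dense_open_pad_true s oO dO.
  by exists (family_pad t).
Qed.

Lemma family_power_sparse_dense : meager (in_cantor F) ->
  exists D : set (family_power F), [/\ countable D, dense D & sparse D].
Proof.
move=> /exists_sparse_dense_of_meager meagerF.
apply: (meagerF _ (fun x : family_power F => set_val (x 0)) (seq (seq bool))
  (fun s => [set x : family_power F |
    forall i, cylinder (nth [::] s i) (set_val (x i))])).
- have proj0 : continuous (fun x : family_power F => x 0).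
    exact: (@proj_continuous nat (fun _ => family_space F) 0).
  move=> x; apply: continuous_comp; first exact: proj0.
  exact: initial_continuous.
- by move=> x; exact: family_space_val.
- move=> U oU [x Ux].
  have [n [V [Vx VU]]] := prod_topology_nbhs (open_nbhs_nbhs (conj oU Ux)).
  have /choice[k kP] i := family_space_nbhs (Vx i).
  exists (mkseq (fun i => mkseq (set_val (x i)) (k i)) n) => y yP.
  by apply: VU => i lti; apply: kP; have := yP i; rewrite nth_mkseq.
- move=> s O oO dO.
  have [t [st Ot]] := dense_open_pad_true (nth [::] s 0) oO dO.
  exists (fun i => family_pad (if i is 0 then t else nth [::] s i)) => //.
  by case=> [|i] //=; exact: cylinder_pad_true.
Qed.

(** The supersets of [A] form a Cantor set in [F].  Adding [A] to a set is not
    injective, but it keeps the coordinates outside [A], and there are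
    infinitely many of them. *)
Lemma family_space_not_sparse (A : set nat) : F A -> infinite_set (~` A) ->
  exists2 E : set (family_space F), countable E & ~ sparse E.
Proof.
move=> FA Ainf.
pose add (y : cantor_space) : cantor_space := fun n => `[< A n >] || y n.
have Fadd y : F [set n | add y n].
  by apply: filterS FA => n An; rewrite /= /add asboolT.
pose psi y := point (Fadd y).
exists (psi @` range pad_true).
  apply: card_le_trans (card_image_le _ _) _.
  exact: card_le_trans (card_image_le _ _) (countableP _).
apply: not_sparse_range_pad_true => [|s].
  apply: (@continuous_comp_initial _ _ _ set_val psi).
  apply: (@continuous_prod _ _ add) => n.
  by apply: (continuous_coordinate (n := n)) => y z yz; rewrite /add yz.
apply: (infinite_image_cylinder Ainf) => y z /(congr1 set_val) yz m Am.
have : add y m = add z m := congr1 (fun x : cantor_space => x m) yz.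
by rewrite /add asboolF.
Qed.

(** The Cantor set consists of the sequences with values in the two-point set
    made of the whole of [nat] and of [nat] without 0. *)
Lemma family_power_not_sparse :
  exists2 E : set (family_power F), countable E & ~ sparse E.
Proof.
pose psi (y : cantor_space) : family_power F :=
  fun i => family_pad (if y i then [::] else [:: false]).
exists (psi @` range pad_true).
  apply: card_le_trans (card_image_le _ _) _.
  exact: card_le_trans (card_image_le _ _) (countableP _).
apply: not_sparse_range_pad_true => [|s].
  apply: continuous_prod => n.
  by apply: (continuous_coordinate (n := n)) => y z yz; rewrite /psi yz.
apply: (infinite_image_cylinder infinite_nat) => y z yz m _.
have := congr1 (fun x : family_power F => (set_val (x m) : cantor_space) 0) yz.
by rewrite /psi /=; case: (y m); case: (z m).
Qed.

(** A surjection of the space onto itself cannot map the whole space onto the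
    complement of a point, and both sets are countable and dense. *)
Lemma frechet_not_cdh : F `<=` @frechet_filter nat ->
  ~ countable_dense_homogeneous (family_space F).
Proof.
move=> Ffrechet [_ cdh].
have Fcnt (D : set (family_space F)) : countable D.
  apply: (@card_le_trans _ _ _ (range family_pad)); last first.
    exact: card_le_trans (card_image_le _ _) (countableP _).
  apply: subset_card_le => x _.
  have [s _ sx] := frechet_range_pad_true (Ffrechet _ (family_space_val x)).
  by exists s => //; exact: val_inj.
have dense1C : dense (~` [set family_pad [::]]).
  move=> O [x Ox] oO.
  have [n nO] := family_space_nbhs (open_nbhs_nbhs (conj oO Ox)).
  exists (family_pad (single_false (mkseq (set_val x) n) n)); split.
    by apply: nO; exact: cylinder_single_false.
  move=> /(congr1 (fun z : family_space F => (set_val z : cantor_space) n)).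
  rewrite !val_family_pad single_falseE ?size_mkseq // eqxx.
  by rewrite /pad_true nth_nil.
have denseT : dense [set: family_space F] by move=> O O0 _; rewrite setIT.
have [h [_ [g [_ gK _]]] hE] := cdh _ _ (Fcnt _) denseT (Fcnt _) dense1C.
have : (~` [set family_pad [::]]) (family_pad [::]).
  by rewrite -hE; exists (g (family_pad [::])).
exact.
Qed.

End filter_spaces.

Theorem proposition1p7 (F : set_system nat) (properF : ProperFilter F)
    (frechetF : @frechet_filter nat `<=` F) :
  countable_dense_homogeneous (family_space F) \/
  countable_dense_homogeneous (family_power F) ->
  ~ meager (in_cantor F).
Proof.
move=> cdh meagerF; case: cdh; last first.
  have [D [Dcnt Dden Dsp]] := family_power_sparse_dense frechetF meagerF.
  have [E Ecnt Ensp] := family_power_not_sparse frechetF.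
  exact: (not_cdh_sparse Dcnt Dden Dsp Ecnt Ensp).
have [Ffrechet|] := pselect (F `<=` @frechet_filter nat).
  exact: (frechet_not_cdh frechetF Ffrechet).
move=> /existsNP[A /not_implyP[FA Ainf]].
have [D [Dcnt Dden Dsp]] := family_space_sparse_dense frechetF meagerF.
have [E Ecnt Ensp] := family_space_not_sparse properF FA Ainf.
exact: (not_cdh_sparse Dcnt Dden Dsp Ecnt Ensp).
Qed.
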